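(* Suppose $p\neq2$ and let $\alpha,\beta,\gamma\in\widehat{\mathbb{F}_q^\times}$. (i) For $\lambda\in\mathbb{F}_q$, $$F_4\!\left({\alpha;\beta\atop\gamma\phi,\phi};\lambda^2,(1-\lambda)^2\right)=(\alpha)_\phi(\beta)_\phi\,F_4\!\left({\alpha\phi;\beta\phi\atop\gamma\phi,\phi};\lambda^2,(1-\lambda)^2\right).$$ (ii) Suppose $\varepsilon\notin\{\alpha,\overline{\beta}\gamma\}$. Then for $\lambda\in\mathbb{F}_q$, $\lambda\neq1$, $$F_4\!\left({\alpha;\beta\atop\gamma\phi,\phi};\lambda^2,(1-\lambda)^2\right)=\frac{g(\overline{\alpha}\beta)g(\alpha\phi)}{g(\beta)g(\phi)}\,\overline{\alpha}^2(1-\lambda)\,F_4\!\left({\alpha;\alpha\phi\atop\gamma\phi,\alpha\overline{\beta}};\frac{\lambda^2}{(1-\lambda)^2},\frac{1}{(1-\lambda)^2}\right).$$ (iii) Suppose $\varepsilon\notin\{\alpha\overline{\beta}\phi,\gamma\}$. Then for $\lambda\in\mathbb{F}_q$, $\lambda\neq1$, $$\overline{\alpha}^2(1-\lambda)\,F_4\!\left({\alpha;\alpha\phi\atop\gamma\phi,\alpha\overline{\beta}};\frac{\lambda^2}{(1-\lambda)^2},\frac{1}{(1-\lambda)^2}\right)=\frac{g(\beta)g(\beta\phi)}{g(\overline{\alpha}\beta)g^\circ(\alpha\beta\phi)}\,{}_3F_2\!\left({\alpha^2,\beta^2,\gamma\atop\alpha\beta\phi,\gamma^2};\lambda\right).$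$
   Context: $\mathbb{F}_q$ is a finite field with $q$ elements and characteristic $p$. $\widehat{\mathbb{F}_q^\times}$ is the group of multiplicative characters $\mathbb{F}_q^\times\to\overline{\mathbb{Q}}^\times$, $\varepsilon$ the trivial character, $\phi$ the quadratic character; every character (including $\varepsilon$) is extended by $0$ at $0$; $\overline{\eta}=\eta^{-1}$; $\delta(\eta)=1$ if $\eta=\varepsilon$, else $0$. $\psi$ is a fixed non-trivial additive character. $g(\eta)=-\sum_{x\in\mathbb{F}_q^\times}\psi(x)\eta(x)$, $g^\circ(\eta)=q^{\delta(\eta)}g(\eta)$, $(\alpha)_\nu=g(\alpha\nu)/g(\alpha)$, $(\alpha)^\circ_\nu=g^\circ(\alpha\nu)/g^\circ(\alpha)$. For $\lambda\in\mathbb{F}_q$, ${}_3F_2\!\left({\alpha_1,\alpha_2,\alpha_3\atop\beta_1,\beta_2};\lambda\right)=\frac{1}{1-q}\sum_{\nu}\frac{(\alpha_1)_\nu(\alpha_2)_\nu(\alpha_3)_\nu}{(\varepsilon)^\circ_\nu(\beta_1)^\circ_\nu(\beta_2)^\circ_\nu}\nu(\lambda)$; Appell's function: for $x,y\in\mathbb{F}_q$, $F_4\!\left({\alpha;\beta\atop\gamma_1,\gamma_2};x,y\right)=\frac{1}{(1-q)^2}\sum_{\nu_1,\nu_2}\frac{(\alpha)_{\nu_1\nu_2}(\beta)_{\nu_1\nu_2}}{(\gamma_1)^\circ_{\nu_1}(\gamma_2)^\circ_{\nu_2}(\varepsilon)^\circ_{\nu_1}(\varepsilon)^\circ_{\nu_2}}\nu_1(x)\nu_2(y)$,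 sums over characters. *)

(* Defs.v *)
From HB Require Import structures.
From mathcomp Require Import all_boot all_order all_algebra all_field.
Set Implicit Arguments.
Unset Strict Implicit.
Unset Printing Implicit Defensive.
Import Order.TTheory GRing.Theory Num.Theory.
Local Open Scope ring_scope.

Section FFHyp.
Variable F : finFieldType.

(* A multiplicative character F^x -> Qbar^x, extended by 0 at 0 (also for the
   trivial character), is exactly a function f : F -> algC with f 0 = 0,
   f 1 = 1 and f (x y) = f x f y for all x, y. *)
Definition mcharb (f : F -> algC) : bool :=
  [&& f 0 == 0, f 1 == 1 & [forall x : F, [forall y : F, f (x * y) == f x * f y]]].

Definition ch_eq (f g : F -> algC) : bool := [forall x : F, f x == g x].

(* All values of characters lie among the roots of X^q - X in algC; this
   finite list gives a finite type over which we enumerate all characters. *)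
Definition rootsq : seq algC :=
  sval (closed_field_poly_normal ('X^#|F| - 'X : {poly algC})).

Definition chfun (f : {ffun F -> seq_sub rootsq}) : F -> algC :=
  fun x => val (f x).

Definition sum_chars (E : (F -> algC) -> algC) : algC :=
  \sum_(f : {ffun F -> seq_sub rootsq} | mcharb (chfun f)) E (chfun f).

Definition chmul (a b : F -> algC) : F -> algC := fun x => a x * b x.
(* inverse character (0^-1 = 0 in MathComp, so the value at 0 stays 0) *)
Definition chinv (a : F -> algC) : F -> algC := fun x => (a x)^-1.
Definition eps : F -> algC := fun x => (x != 0)%:R.
Definition phi : F -> algC :=
  fun x => if x == 0 then 0 else if [exists y : F, y ^+ 2 == x] then 1 else -1.

Definition delta (a : F -> algC) : nat := ch_eq a eps.

Definition qC : algC := #|F|%:R.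

Variable psi : F -> algC.

Definition gauss (eta : F -> algC) : algC :=
  - \sum_(x : F | x != 0) psi x * eta x.
Definition gauss0 (eta : F -> algC) : algC := qC ^+ delta eta * gauss eta.

Definition poch (a n : F -> algC) : algC := gauss (chmul a n) / gauss a.
Definition poch0 (a n : F -> algC) : algC := gauss0 (chmul a n) / gauss0 a.

Definition F32 (a1 a2 a3 b1 b2 : F -> algC) (l : F) : algC :=
  (1 - qC)^-1 * sum_chars (fun n =>
    poch a1 n * poch a2 n * poch a3 n / (poch0 eps n * poch0 b1 n * poch0 b2 n) * n l).

Definition appellF4 (a b c1 c2 : F -> algC) (x y : F) : algC :=
  ((1 - qC) ^+ 2)^-1 * sum_chars (fun n1 => sum_chars (fun n2 =>
    poch a (chmul n1 n2) * poch b (chmul n1 n2)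
      / (poch0 c1 n1 * poch0 c2 n2 * poch0 eps n1 * poch0 eps n2)
      * n1 x * n2 y)).

End FFHyp.

(* Main.v *)
Require Import Defs.
From Stdlib Require Import FunctionalExtensionality.
From HB Require Import structures.
From mathcomp Require Import all_boot all_order all_algebra all_solvable all_field.
From mathcomp Require Import ring.
Import Order.TTheory GRing.Theory Num.Theory.
Local Open Scope ring_scope.

(* With W_{a,b}(z) = sum_{st=z} a(s) b(t) psi(s+t), the product g(a n) g(b n) is
   the Mellin transform of W_{a,b} at n, and 1/g0(n) = n(-1) g(n^-1)/q.  Hence
   Mellin inversion turns F4(a;b;c1,c2;x,y) into a multiple of
     sum_z W_{a,b}(z) K_{c1}(zx) K_{c2}(zy),   K_c = W_{c^-1,eps},
   where K_c plays the role of a Bessel function.  For c2 = phi, K_phi is a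
   Salie sum: it is supported on squares and
   K_phi(w^2) = - g(phi) (psi(2w) + psi(-2w)).  The support gives (i).
   Parametrizing by w, both sides of (ii) become multiples of
     S(l) = sum_u a^2(u) psi(2(1-l)u) K_{a/b}(u^2) K_{c phi}(l^2 u^2).
   For (iii), psi(2(1-l)u) = psi(2u) psi(-2lu); the Mellin transform of
   psi(2u) K_{h phi}(u^2) is a quotient of Gauss sums when h is not trivial, so
   expanding the factor that depends on l in characters yields the 3F2 series. *)

(** * Multiplicative characters, sums over them, orthogonality and Mellin inversion *)

Section Characters.
Set Implicit Arguments.
Unset Strict Implicit.
Variable F : finFieldType.
Implicit Types (a b c : F -> algC) (x y z : F).

Lemma mcharP a :
  reflect [/\ a 0 = 0, a 1 = 1 & forall x y, a (x * y) = a x * a y] (mcharb a).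
Proof.
apply: (iffP and3P) => [[/eqP a0 /eqP a1 /forallP aM] | [a0 a1 aM]]; split=> //.
- by move=> x y; have /forallP/(_ y)/eqP := aM x.
- exact/eqP.
- exact/eqP.
- by apply/forallP => x; apply/forallP => y; apply/eqP.
Qed.

Lemma mchar0 a : mcharb a -> a 0 = 0. Proof. by case/mcharP. Qed.
Lemma mchar1 a : mcharb a -> a 1 = 1. Proof. by case/mcharP. Qed.
Lemma mcharM a : mcharb a -> {morph a : x y / x * y}.
Proof. by case/mcharP. Qed.

Lemma mchar_neq0 a x : mcharb a -> x != 0 -> a x != 0.
Proof.
move=> Ha nx; apply/eqP => ax0.
have := oner_neq0 algC.
by rewrite -(mchar1 Ha) -(divff nx) mcharM // ax0 mul0r eqxx.
Qed.

Lemma mcharV a x : mcharb a -> a x^-1 = (a x)^-1.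
Proof.
move=> Ha; have [->|nx] := eqVneq x 0; first by rewrite !(invr0, mchar0).
apply: (mulfI (mchar_neq0 Ha nx)).
by rewrite -mcharM // !mulfV ?mchar1 ?mchar_neq0.
Qed.

Lemma mcharX a x k : mcharb a -> a (x ^+ k) = a x ^+ k.
Proof.
by move=> Ha; elim: k => [|k IH]; rewrite ?mchar1 // !exprS mcharM // IH.
Qed.

Lemma mchar_sqN1 a : mcharb a -> a (-1) ^+ 2 = 1.
Proof. by move=> Ha; rewrite -mcharX // sqrrN expr1n mchar1. Qed.

Lemma mcharN1 a : mcharb a -> a (-1) = 1 \/ a (-1) = -1.
Proof.
by move/mchar_sqN1/eqP; rewrite sqrf_eq1 => /orP[]/eqP; [left | right].
Qed.

Lemma chmulE a b x : chmul a b x = a x * b x. Proof. by []. Qed.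
Lemma chinvE a x : chinv a x = (a x)^-1. Proof. by []. Qed.

Lemma mcharb_mul a b : mcharb a -> mcharb b -> mcharb (chmul a b).
Proof.
move=> Ha Hb; apply/mcharP; rewrite /chmul; split=> [||x y].
- by rewrite !mchar0 // mul0r.
- by rewrite !mchar1 // mul1r.
- by rewrite !mcharM // mulrACA.
Qed.

Lemma mcharb_inv a : mcharb a -> mcharb (chinv a).
Proof.
move=> Ha; apply/mcharP; rewrite /chinv; split=> [||x y].
- by rewrite mchar0 // invr0.
- by rewrite mchar1 // invr1.
- by rewrite mcharM // invfM.
Qed.

Lemma mcharb_eps : mcharb (@eps F).
Proof.
apply/mcharP; rewrite /eps; split=> [||x y]; rewrite ?eqxx ?oner_neq0 //.
by rewrite mulf_eq0 negb_or -natrM mulnb.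
Qed.

Lemma ch_eqP a b : reflect (a = b) (ch_eq a b).
Proof.
apply: (iffP forallP) => [ab | -> x] //.
by apply: functional_extensionality => x; apply/eqP.
Qed.

(** Since x^q = x in F, multiplicativity makes a x a root of X^q - X. *)
Lemma mem_rootsq a x : mcharb a -> a x \in rootsq F.
Proof.
move=> Ha; rewrite /rootsq; case: closed_field_poly_normal => /= r Dr.
have q1 : (1 < #|F|)%N by apply: finNzRing_gt1.
have nz : 'X^#|F| - 'X != 0 :> {poly algC}.
  by rewrite -size_poly_eq0 size_polyDl size_polyXn // size_polyN size_polyX.
have : root ('X^#|F| - 'X) (a x).
  by rewrite rootE !hornerE -mcharX // expf_card subrr.
by rewrite Dr rootZ ?root_prod_XsubC // lead_coef_eq0.
Qed.

(** Inverse of [chfun] on characters. The default of [insubd] is never reached there, by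
    [mem_rootsq]. *)
Definition encode a : {ffun F -> seq_sub (rootsq F)} :=
  [ffun x => insubd (SeqSub (mem_rootsq 0 mcharb_eps)) (a x)].

Lemma encodeK a : mcharb a -> chfun (encode a) = a.
Proof.
move=> Ha; apply: functional_extensionality => x.
by rewrite /chfun ffunE insubdK //; apply: mem_rootsq.
Qed.

Lemma chfunK (f : {ffun F -> seq_sub (rootsq F)}) : encode (chfun f) = f.
Proof. by apply/ffunP => x; rewrite ffunE; apply/val_inj/insubdK/valP. Qed.

Lemma eq_sum_chars (E E' : (F -> algC) -> algC) :
  (forall n, mcharb n -> E n = E' n) -> sum_chars E = sum_chars E'.
Proof. by move=> EE'; apply: eq_bigr => f Hf; apply: EE'. Qed.

Lemma mulr_sum_chars (k : algC) (E : (F -> algC) -> algC) :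
  k * sum_chars E = sum_chars (fun n => k * E n).
Proof. exact: mulr_sumr. Qed.

Lemma exchange_sum_chars (I : finType) (E : (F -> algC) -> I -> algC) :
  sum_chars (fun n => \sum_i E n i) = \sum_i sum_chars (E^~ i).
Proof. exact: exchange_big. Qed.

Lemma sum_chars_shift c (E : (F -> algC) -> algC) :
  mcharb c -> sum_chars E = sum_chars (fun n => E (chmul c n)).
Proof.
move=> Hc; have Hc' := mcharb_inv Hc; rewrite /sum_chars.
have mulK (d e : F -> algC) : mcharb d -> mcharb e ->
    chmul d (chmul (chinv d) e) = e /\ chmul (chinv d) (chmul d e) = e.
  move=> Hd He; split; apply: functional_extensionality => x; rewrite /chmul /chinv.
    have [->|nx] := eqVneq x 0; first by rewrite (mchar0 Hd) (mchar0 He) mul0r.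
    by rewrite mulVKf ?mchar_neq0.
  have [->|nx] := eqVneq x 0; first by rewrite (mchar0 Hd) (mchar0 He) !mulr0.
  by rewrite mulKf ?mchar_neq0.
(* Translation by d, carried to the finite encoding. [h (chinv c)] inverts [h c] only on codes of
   characters, whence [reindex_onto]. *)
pose h d (f : {ffun F -> seq_sub (rootsq F)}) := encode (chmul d (chfun f)).
rewrite (reindex_onto (h c) (h (chinv c))); last first.
  move=> f Hf; rewrite /h encodeK ?mcharb_mul //.
  by rewrite (proj1 (mulK _ _ _ _)) // chfunK.
apply: eq_big => [f | f /andP[Hf /eqP hf]]; last first.
  by rewrite /h encodeK // mcharb_mul // -hf encodeK mcharb_mul.
apply/andP/idP => [[Hf /eqP <-] | Hf].
  by rewrite /h encodeK mcharb_mul.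
split; first by rewrite /h encodeK mcharb_mul.
by rewrite /h encodeK ?mcharb_mul // (proj2 (mulK _ _ _ _)) // chfunK.
Qed.

(** If a is not trivial, pick y with a y != 1: replacing x by y x multiplies the sum by a y, so it
    vanishes. *)
Lemma sum_mchar a :
  mcharb a -> \sum_x a x = (ch_eq a (@eps F))%:R * (#|F|%:R - 1).
Proof.
move=> Ha; case: ch_eqP => [-> | nea].
  rewrite mul1r (bigD1 0) //= {1}/eps eqxx add0r.
  rewrite (eq_bigr (fun=> 1)) => [|x nx]; last by rewrite /eps nx.
  rewrite sumr_const cardC1 -subn1 natrB //.
  exact/ltnW/finNzRing_gt1.
rewrite mul0r.
have [y ny ay] : exists2 y, y != 0 & a y != 1.
  have [/existsP[y /andP[ny ay]]|] := boolP [exists y, (y != 0) && (a y != 1)].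
    by exists y.
  rewrite negb_exists => /forallP all1; case: nea.
  apply: functional_extensionality => x; rewrite /eps.
  have := all1 x; rewrite negb_and negbK.
  have [-> _|_ /=] := eqVneq x 0; first exact: mchar0.
  by rewrite negbK => /eqP.
have : (1 - a y) * \sum_x a x = 0.
  rewrite mulrBl mul1r mulr_sumr [X in X - _](reindex_inj (mulfI ny)) /=.
  by rewrite -sumrB big1 // => x _; rewrite mcharM // subrr.
by move/eqP; rewrite mulf_eq0 subr_eq0 eq_sym (negPf ay) => /eqP.
Qed.

(** The q - 1 nonzero elements are distinct roots of X^(q-1) - 1, and a field with that many of them
    has a primitive one. *)
Lemma finField_prim_root : exists w : F, (#|F|.-1).-primitive_root w.
Proof.
have n0 : (0 < #|F|.-1)%N by rewrite -ltnS prednK ?finNzRing_gt1 // ltnW ?finNzRing_gt1.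
pose rs := [seq x <- enum F | x != 0].
have := @has_prim_root F _ rs n0; case/(_ _ _ _)/hasP.
- apply/allP => x; rewrite mem_filter => /andP[nx _].
  apply/unity_rootP/(mulfI nx); rewrite mulr1 -exprS prednK ?expf_card //.
  by rewrite ltnW ?finNzRing_gt1.
- by rewrite filter_uniq ?enum_uniq.
- by rewrite size_filter -(cardC1 (0 : F)) cardE enumT -size_filter.
- by move=> w _; exists w.
Qed.

Lemma prim_root_log (w x : F) :
  (#|F|.-1).-primitive_root w -> x != 0 -> exists i, x = w ^+ i.
Proof.
move=> prw nx; have [|i ->] := prim_rootP prw (x := x); last by exists i.
apply: (mulfI nx); rewrite mulr1 -exprS prednK ?expf_card //.
by rewrite ltnW ?finNzRing_gt1.
Qed.

(** The witness sends a generator w of the group of units to a primitive (q-1)-th root of unity z in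
    [algC]. It is injective on nonzero elements, so one character separates every x from 1. *)
Lemma mchar_separates x : x != 0 -> x != 1 -> exists2 c, mcharb c & c x != 1.
Proof.
move=> nx x1; have [w prw] := finField_prim_root.
have n0 := prim_order_gt0 prw.
have [z prz] := C_prim_root_exists n0.
pose c y := if [pick i : 'I_(#|F|.-1) | y == w ^+ i] is Some i then z ^+ i else 0.
have cE i : c (w ^+ i) = z ^+ i.
  rewrite /c; case: pickP => [j /eqP Dj | /(_ (Ordinal (ltn_pmod i n0)))/=].
    by apply/eqP; rewrite (eq_prim_root_expr prz) -(eq_prim_root_expr prw) Dj.
  by rewrite (prim_expr_mod prw) eqxx.
have c0 : c 0 = 0.
  rewrite /c; case: pickP => // j /eqP/esym/eqP.
  rewrite expf_eq0 => /andP[_ /eqP w0]; have := prim_expr_order prw.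
  by rewrite w0 expr0n gtn_eqF // => /eqP; rewrite eq_sym oner_eq0.
exists c.
  apply/mcharP; split=> // [|y1 y2]; first by rewrite -(expr0 w) cE.
  have [->|n1] := eqVneq y1 0; first by rewrite mul0r c0 mul0r.
  have [->|n2] := eqVneq y2 0; first by rewrite mulr0 c0 mulr0.
  have [i ->] := prim_root_log prw n1.
  have [j ->] := prim_root_log prw n2.
  by rewrite -exprD !cE exprD.
have [i Di] := prim_root_log prw nx.
apply: contraNneq x1; rewrite Di cE => zi1.
by rewrite -(expr0 w) (eq_prim_root_expr prw) -(eq_prim_root_expr prz) zi1.
Qed.

Lemma sum_chars_eval x : x != 0 ->
  sum_chars (fun n => n x) = (x == 1)%:R * (#|F|%:R - 1).
Proof.
have sep y : y != 0 -> y != 1 -> sum_chars (fun n => n y) = 0.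
  move=> ny y1; have [c Hc cy] := mchar_separates ny y1.
  have : (1 - c y) * sum_chars (fun n => n y) = 0.
    rewrite mulrBl mul1r [X in X - _](sum_chars_shift (fun n => n y) Hc).
    by rewrite mulr_sum_chars subrr.
  by move/eqP; rewrite mulf_eq0 subr_eq0 eq_sym (negPf cy) => /eqP.
move=> nx; case: (eqVneq x 1) => [-> | x1]; last by rewrite sep // mul0r.
(* Double counting of the sum of all n y shows that there are q - 1 characters. *)
rewrite mul1r; transitivity (\sum_(y : F) sum_chars (fun n => n y)).
  rewrite (bigD1 1) //= big1 ?addr0 // => y y1.
  have [->|ny] := eqVneq y 0; last exact: sep.
  by rewrite /sum_chars big1 // => f; apply: mchar0.
rewrite -(exchange_sum_chars (fun n (y : F) => n y)).
rewrite (eq_sum_chars sum_mchar) /sum_chars.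
rewrite (bigD1 (encode (@eps F))) ?encodeK ?mcharb_eps //=.
rewrite (introT (ch_eqP _ _)) // mul1r big1 ?addr0 // => f /andP[_ nf].
case: ch_eqP => [fE|_]; last by rewrite mul0r.
by rewrite -fE chfunK eqxx in nf.
Qed.

(** By orthogonality the sum over n of n (z / u) leaves only u = z. At z = 0 every character
    vanishes, so f must vanish there too. *)
Lemma mellin_inversion (f : F -> algC) z : f 0 = 0 ->
  sum_chars (fun n => n z * \sum_u chinv n u * f u) = (#|F|%:R - 1) * f z.
Proof.
move=> f0; have [->|nz] := eqVneq z 0.
  rewrite f0 mulr0 /sum_chars big1 // => g Hg.
  by rewrite mchar0 // mul0r.
under eq_sum_chars do rewrite mulr_sumr.
rewrite exchange_sum_chars (bigD1 z) //= [X in _ + X]big1 ?addr0 => [|u uz].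
  rewrite (eq_sum_chars (E' := fun n => f z * n 1)) => [|n Hn].
    by rewrite -mulr_sum_chars sum_chars_eval ?oner_neq0 // eqxx mul1r mulrC.
  by rewrite /chinv mulrA mulfV ?mchar_neq0 // mchar1 // mulrC.
have [->|nu] := eqVneq u 0.
  by rewrite f0 /sum_chars big1 // => n _; rewrite !mulr0.
rewrite (eq_sum_chars (E' := fun n => f u * n (z / u))) => [|n Hn].
  rewrite -mulr_sum_chars sum_chars_eval ?mulf_neq0 ?invr_neq0 //.
  have /negPf-> : z / u != 1; last by rewrite mul0r mulr0.
  by apply: contraNneq uz => /divr1_eq->.
by rewrite mulrA /chinv -mcharV // -mcharM // mulrC.
Qed.

End Characters.

(** * The quadratic character and the counting of square roots *)

Section QuadraticCharacter.
Set Implicit Arguments.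
Unset Strict Implicit.
Variable F : finFieldType.
Implicit Types (a b c : F -> algC) (x y z : F).
Local Notation phi := (@Defs.phi F).

Lemma phi_square x : x != 0 -> phi (x ^+ 2) = 1.
Proof.
move=> nx; rewrite /Defs.phi expf_eq0 (negPf nx) andbF.
by case: existsP => // -[]; exists x.
Qed.

Lemma phi_eq1 x : phi x = 1 -> exists y, x = y ^+ 2.
Proof.
rewrite /Defs.phi; case: eqP => [_ /eqP|_]; first by rewrite eq_sym oner_eq0.
case: existsP => [[y /eqP <-] _|_ /eqP]; first by exists y.
by rewrite -subr_eq0 -opprD oppr_eq0 -(natrD _ 1 1) pnatr_eq0.
Qed.

Lemma phi_cases x : x != 0 -> phi x = 1 \/ phi x = -1.
Proof.
by rewrite /Defs.phi => /negPf->; case: ifP; [left | right].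
Qed.

(** Multiplying by a nonzero square does not change [phi]. Two nonsquares are odd powers of a
    generator, so their product is an even power, hence a square. *)
Lemma mcharb_phi : mcharb phi.
Proof.
have phi0 : phi 0 = 0 by rewrite /Defs.phi eqxx.
have phi1 : phi 1 = 1 by rewrite -(expr1n F 2) phi_square ?oner_neq0.
have [w prw] := finField_prim_root F.
have w0 : w != 0.
  apply/eqP => w0; have := prim_expr_order prw.
  by rewrite w0 expr0n gtn_eqF ?(prim_order_gt0 prw) // => /eqP; rewrite eq_sym oner_eq0.
have N1 : (-1 : algC) != 1.
  by rewrite -subr_eq0 -opprD oppr_eq0 -(natrD _ 1 1) pnatr_eq0.
have sq_mul x y : phi x = 1 -> phi (x * y) = phi y.
  have [->|ny] := eqVneq y 0; first by rewrite mulr0.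
  have [->|nx] := eqVneq x 0; first by rewrite phi0 => /eqP; rewrite eq_sym oner_eq0.
  case/phi_eq1 => z Dx; rewrite Dx in nx *.
  have nz : z != 0 by apply: contraNneq nx => ->; rewrite expr0n.
  have [y1|yN1] := phi_cases ny.
    have [u Dy] := phi_eq1 y1; rewrite y1 Dy -exprMn phi_square //.
    by rewrite mulf_neq0 // -sqrf_eq0 -Dy.
  have [zy1|->] := phi_cases (mulf_neq0 nx ny); last by [].
  have [u Du] := phi_eq1 zy1; case/eqP: N1; rewrite -yN1.
  have Dy : y = (u / z) ^+ 2 by rewrite exprMn exprVn -Du mulrC mulKf.
  by rewrite Dy phi_square // -sqrf_eq0 -Dy.
have odd_log i : phi (w ^+ i) = -1 -> odd i.
  move=> Di; apply/negPn/negP => evi; case/eqP: N1; rewrite -Di.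
  by rewrite -[i]odd_double_half (negPf evi) add0n -muln2 exprM phi_square ?expf_neq0.
apply/mcharP; split=> // x y.
have [->|nx] := eqVneq x 0; first by rewrite mul0r phi0 mul0r.
have [->|ny] := eqVneq y 0; first by rewrite mulr0 phi0 mulr0.
have [x1|xN1] := phi_cases nx; first by rewrite sq_mul // x1 mul1r.
have [y1|yN1] := phi_cases ny; first by rewrite mulrC sq_mul // y1 mulr1.
rewrite xN1 yN1 mulrNN mulr1.
have [i Dx] := prim_root_log prw nx; have [j Dy] := prim_root_log prw ny.
rewrite Dx in xN1; rewrite Dy in yN1.
rewrite Dx Dy -exprD -[(i + j)%N]odd_double_half oddD !odd_log // add0n.
by rewrite -muln2 exprM phi_square ?expf_neq0.
Qed.

Lemma phiV : chinv phi = phi.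
Proof.
apply: functional_extensionality => x; rewrite /chinv.
have [->|nx] := eqVneq x 0; first by rewrite (mchar0 mcharb_phi) invr0.
by have [->|->] := phi_cases nx; rewrite ?invrN invr1.
Qed.

Lemma phi_sqr x : x != 0 -> phi x * phi x = 1.
Proof. by move=> nx; rewrite -(mcharM mcharb_phi) -expr2 phi_square. Qed.

(** Such an a has values 1 and -1 on units and is 1 on nonzero squares. If it is 1 at one nonsquare
    x, then it is 1 at every nonsquare y, because x y is a square; so it is trivial. *)
Lemma mchar_sqr_eps a : mcharb a -> chmul a a = @eps F -> a = @eps F \/ a = phi.
Proof.
move=> Ha aa.
have a1 x : x != 0 -> a x = 1 \/ a x = -1.
  move=> nx; have := congr1 (fun f => f x) aa; rewrite /chmul /eps nx => /eqP.
  by rewrite -expr2 sqrf_eq1 => /orP[]/eqP; [left | right].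
have a_sq x : phi x = 1 -> a x = 1.
  have [->|nx] := eqVneq x 0.
    by rewrite (mchar0 mcharb_phi) => /eqP; rewrite eq_sym oner_eq0.
  case/phi_eq1 => y Dx; rewrite Dx in nx *.
  have ny : y != 0 by apply: contraNneq nx => ->; rewrite expr0n.
  by rewrite mcharX //; case: (a1 _ ny) => ->; rewrite ?sqrrN expr1n.
case: (ch_eqP a (@eps F)) => [|nea]; first by left.
right; apply: functional_extensionality => x.
have [->|nx] := eqVneq x 0; first by rewrite !mchar0 ?mcharb_phi.
have [x1|xN1] := phi_cases nx; first by rewrite x1 a_sq.
rewrite xN1; case: (a1 _ nx) => // ax; case: nea.
apply: functional_extensionality => y; rewrite /eps.
have [->|ny] := eqVneq y 0; first exact: mchar0.
have [y1|yN1] := phi_cases ny; first exact: a_sq.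
rewrite -[a y]mul1r -ax -mcharM // a_sq //.
by rewrite (mcharM mcharb_phi) xN1 yN1 mulrNN mulr1.
Qed.

Hypothesis two_neq0 : (2 : F) != 0.

(** The weight 1 + phi t is the number of square roots of t; for a nonzero square it is 2 because y
    and -y differ when 2 != 0. *)
Lemma sum_squares (h : F -> algC) :
  \sum_y h (y ^+ 2) = \sum_t (1 + phi t) * h t.
Proof.
rewrite (partition_big (fun y => y ^+ 2) predT) //=; apply: eq_bigr => t _.
have [->|nt] := eqVneq t 0.
  rewrite (mchar0 mcharb_phi) addr0 mul1r (big_pred1 0) ?expr0n // => y.
  by rewrite /= sqrf_eq0.
have [t1|tN1] := phi_cases nt; last first.
  rewrite tN1 subrr mul0r big1 // => y /eqP Dt; move: tN1.
  rewrite -Dt phi_square; last by rewrite -sqrf_eq0 Dt.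
  by move/eqP; rewrite -subr_eq0 opprK -(natrD _ 1 1) pnatr_eq0.
have [y Dt] := phi_eq1 t1; rewrite t1.
have nyN : - y != y.
  rewrite -subr_eq0 -opprD oppr_eq0 -mulr2n -mulr_natl mulf_neq0 //.
  by rewrite -sqrf_eq0 -Dt.
rewrite (bigD1 y) ?Dt //= (bigD1 (- y)) /= ?sqrrN ?eqxx ?nyN //.
rewrite big1 ?addr0 ?mulrDl ?mul1r // => z /andP[/andP[]].
by rewrite eqf_sqr => /orP[]/eqP-> /negPf; rewrite eqxx // => _; rewrite eqxx.
Qed.

(** Taking h = 1 in [sum_squares] shows that the values of [phi] sum to 0, whereas those of [eps]
    sum to q - 1. *)
Lemma phi_neq_eps : phi <> @eps F.
Proof.
move=> phiE; have := sum_squares (fun=> 1).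
under [in X in _ = X -> _]eq_bigr do rewrite mulr1.
rewrite big_split /= -[X in X = _ -> _]addr0 => /addrI/esym/eqP.
rewrite sum_mchar ?mcharb_phi // (introT (ch_eqP _ _)) // mul1r subr_eq0.
by rewrite pnatr_eq1 gtn_eqF ?finNzRing_gt1.
Qed.

End QuadraticCharacter.

(** Proves identities between products of characters pointwise: both sides vanish at 0, and at a
    unit all values are nonzero and [phi] is 1 or -1, so [field] concludes. *)
Ltac char_eq :=
  let x := fresh "x" in let nx := fresh "nx" in
  apply: functional_extensionality => x; rewrite /chmul /chinv; have [->|nx] := eqVneq x 0;
  [ rewrite !mchar0 ?mcharb_eps ?mcharb_phi // ?invr0 ?mulr0 ?mul0r ?invr0 ?mulr0 //
  | repeat match goal with H : is_true (mcharb ?a) |- _ =>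
      move: (mchar_neq0 H nx); clear H => ? end;
    rewrite /eps ?nx /=; try (case: (phi_cases nx) => ->); field; do ?[apply/andP; split]; done ].

(** * Gauss sums, the reflection formula and Jacobi sums *)

Section GaussSums.
Set Implicit Arguments.
Unset Strict Implicit.
Variables (F : finFieldType) (psi : F -> algC).
Hypothesis psi_add : forall x y : F, psi (x + y) = psi x * psi y.
Hypothesis psi_unit : forall x : F, psi x != 0.
Hypothesis psi_nontriv : exists x : F, psi x != 1.
Implicit Types (a b c r n : F -> algC) (x y z : F).
Local Notation phi := (@Defs.phi F).
Local Notation eps := (@Defs.eps F).
Local Notation q := (qC F).
Local Notation g := (gauss psi).
Local Notation g0 := (gauss0 psi).

Lemma qC_neq0 : q != 0.
Proof. by rewrite pnatr_eq0 -lt0n ltnW // finNzRing_gt1. Qed.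

Lemma qC_neq1 : q - 1 != 0.
Proof. by rewrite subr_eq0 pnatr_eq1 gtn_eqF // finNzRing_gt1. Qed.

Lemma psi0 : psi 0 = 1.
Proof. by apply: (mulfI (psi_unit 0)); rewrite -psi_add addr0 mulr1. Qed.

Lemma sum_psi x : \sum_s psi (s * x) = (x == 0)%:R * q.
Proof.
have [->|nx] := eqVneq x 0.
  rewrite mul1r (eq_bigr (fun=> 1)) => [|s _]; last by rewrite mulr0 psi0.
  by rewrite sumr_const.
have -> : \sum_s psi (s * x) = \sum_s psi s by rewrite [RHS](reindex_inj (mulIf nx)).
rewrite mul0r.
have [y y1] := psi_nontriv.
have : (1 - psi y) * \sum_s psi s = 0.
  rewrite mulrBl mul1r mulr_sumr [X in X - _](reindex_inj (addrI y)) /=.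
  by rewrite -sumrB big1 // => s _; rewrite psi_add subrr.
by move/eqP; rewrite mulf_eq0 subr_eq0 eq_sym (negPf y1) => /eqP.
Qed.

Lemma gaussE c : mcharb c -> g c = - \sum_x psi x * c x.
Proof.
by move=> Hc; rewrite /gauss [in RHS](bigD1 0) //= (mchar0 Hc) mulr0 add0r.
Qed.

Lemma sum_psi_neq0 x : \sum_(s | s != 0) psi (s * x) = (x == 0)%:R * q - 1.
Proof. by rewrite -sum_psi [in RHS](bigD1 0) //= mul0r psi0 addrAC subrr add0r. Qed.

Lemma sum_psi_twist c x : mcharb c -> x != 0 ->
  \sum_s psi (s * x) * c s = - (c x)^-1 * g c.
Proof.
move=> Hc nx; rewrite gaussE // mulrN mulNr opprK mulr_sumr.
rewrite [RHS](reindex_inj (mulIf nx)) /=; apply: eq_bigr => s _.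
by rewrite (mcharM Hc) mulrCA [c s * _]mulrC mulKf ?mchar_neq0.
Qed.

Lemma gauss_eps : g eps = 1.
Proof.
have := sum_psi 1; rewrite oner_eq0 mul0r (bigD1 0) //= mul0r psi0 => /eqP.
rewrite addr_eq0 => /eqP->; rewrite /gauss; congr (- _).
by apply: eq_bigr => x nx; rewrite /Defs.eps nx !mulr1.
Qed.

Lemma gauss0_eps : g0 eps = q.
Proof.
by rewrite /gauss0 /delta (introT (ch_eqP _ _)) // expr1 gauss_eps mulr1.
Qed.

Lemma gauss0_nontriv c : ~~ ch_eq c eps -> g0 c = g c.
Proof. by rewrite /gauss0 /delta => /negPf->; rewrite expr0 mul1r. Qed.

Lemma chinvK c : chinv (chinv c) = c.
Proof. by apply: functional_extensionality => x; rewrite /chinv invrK. Qed.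

Lemma chinvM a b : chinv (chmul a b) = chmul (chinv a) (chinv b).
Proof. by apply: functional_extensionality => x; rewrite /chinv /chmul invfM. Qed.

Lemma chinv_eps : chinv eps = eps.
Proof.
apply: functional_extensionality => x; rewrite /chinv /Defs.eps.
by case: (x != 0); rewrite ?invr1 ?invr0.
Qed.

(** For c nontrivial, put x = y m in the double sum: summing psi (y (m + 1)) over y != 0 gives q at
    m = -1, minus 1 for every m, and the latter part dies because c sums to 0. For c trivial the
    factor q comes from [g0]. *)
Lemma gauss_reflection c : mcharb c -> g c * g0 (chinv c) = c (-1) * q.
Proof.
move=> Hc; have Hc' := mcharb_inv Hc.
case: (boolP (ch_eq c eps)) => [/ch_eqP->|nc].
  by rewrite chinv_eps gauss_eps gauss0_eps /Defs.eps oppr_eq0 oner_neq0.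
rewrite gauss0_nontriv; last first.
  by apply: contra nc => /ch_eqP cE; rewrite -[c]chinvK cE chinv_eps; apply/ch_eqP.
rewrite !gaussE // mulrNN mulr_sumr.
transitivity (\sum_(y | y != 0) \sum_m c m * psi (y * (m + 1))).
  rewrite (bigD1 0) //= (mchar0 Hc') !mulr0 add0r; apply: eq_bigr => y ny.
  rewrite mulr_suml (reindex_inj (mulfI ny)) /=; apply: eq_bigr => m _.
  rewrite mulrDr mulr1 psi_add (mcharM Hc) /chinv.
  by field; rewrite mchar_neq0.
rewrite exchange_big /=.
under eq_bigr => m _ do rewrite -mulr_sumr sum_psi_neq0 mulrBr mulr1.
rewrite sumrB (sum_mchar Hc) (negPf nc) mul0r subr0.
rewrite (bigD1 (-1)) //= addNr eqxx mul1r big1 ?addr0 // => m mN1.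
by rewrite addr_eq0 (negPf mN1) mul0r mulr0.
Qed.

Lemma gauss_neq0 c : mcharb c -> g c != 0.
Proof.
move=> Hc; have E := gauss_reflection Hc; apply/eqP => gc0.
move/eqP: E; rewrite gc0 mul0r eq_sym; apply/negP.
by rewrite mulf_neq0 ?qC_neq0 ?mchar_neq0 ?oppr_eq0 ?oner_neq0.
Qed.

Lemma gauss0_neq0 c : mcharb c -> g0 c != 0.
Proof. by move=> Hc; rewrite mulf_neq0 ?gauss_neq0 ?expf_neq0 ?qC_neq0. Qed.

Lemma gauss0V c : mcharb c -> (g0 c)^-1 = c (-1) * g (chinv c) / q.
Proof.
move=> Hc; have Hc' := mcharb_inv Hc; have := gauss_reflection Hc'.
rewrite chinvK => E; apply: (mulIf (gauss0_neq0 Hc)).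
rewrite mulVf ?gauss0_neq0 // mulrAC -[_ * _ * g0 c]mulrA E /chinv.
by field; rewrite qC_neq0 mchar_neq0 ?oppr_eq0 ?oner_neq0.
Qed.

(** Group the terms of g c * g r by the sum s of the two arguments: s != 0 yields g (c r) times the
    Jacobi sum, up to the sign c (-1) due to 1 + m in place of 1 - m, and s = 0 contributes only if
    c r is trivial. In that case the Jacobi sum is -1, and the q in [g0] keeps the formula uniform.
    With c and r both trivial the sum would be q - 2 and the formula would fail. *)
Lemma jacobi_sum c r : mcharb c -> mcharb r -> ~~ (ch_eq c eps && ch_eq r eps) ->
  g0 (chmul c r) * \sum_m c m * r (1 + m) = - c (-1) * g c * g r.
Proof.
move=> Hc Hr ncr; have Hcr := mcharb_mul Hc Hr.
have N1 : (-1 : F) != 0 by rewrite oppr_eq0 oner_neq0.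
set J := \sum_m _.
have E : g c * g r = - c (-1) * g (chmul c r) * J
           + r (-1) * (ch_eq (chmul c r) eps)%:R * (q - 1).
  transitivity (\sum_s psi s * \sum_x c x * r (s - x)).
    rewrite !gaussE // mulrNN mulr_suml.
    under [RHS]eq_bigr do rewrite mulr_sumr.
    rewrite exchange_big /=; apply: eq_bigr => x _.
    rewrite mulr_sumr [RHS](reindex_inj (addrI x)) /=; apply: eq_bigr => y _.
    by rewrite psi_add [x + y]addrC addrK; ring.
  rewrite (bigD1 0) //= addrC; congr (_ + _).
    rewrite gaussE // mulrNN.
    rewrite [in RHS](bigD1 0) //= (mchar0 Hcr) mulr0 add0r [c (-1) * _]mulr_sumr mulr_suml.
    apply: eq_bigr => s ns.
    rewrite (reindex_inj (mulfI ns)) (reindex_inj (@oppr_inj F)) /= /J !mulr_sumr.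
    apply: eq_bigr => m _; rewrite mulrN opprK /chmul.
    have -> : s + s * m = s * (1 + m) by ring.
    have -> : - (s * m) = s * (-1 * m) by ring.
    by rewrite !(mcharM Hc) (mcharM Hr); ring.
  rewrite psi0 mul1r -mulrA -sum_mchar // mulr_sumr; apply: eq_bigr => x _.
  by rewrite sub0r -[- x]mulN1r (mcharM Hr) /chmul; ring.
case: (boolP (ch_eq (chmul c r) eps)) E => [/ch_eqP crE | ncrE] E; last first.
  rewrite gauss0_nontriv // -[RHS]mulrA E /= !(mulr0, mul0r) addr0.
  have := mchar_sqN1 Hc; rewrite expr2 => c1.
  by transitivity (c (-1) * c (-1) * g (chmul c r) * J); [rewrite c1 mul1r | ring].
have Dr : r = chinv c.
  apply: functional_extensionality => x; have := congr1 (fun f => f x) crE.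
  rewrite /chmul /chinv /Defs.eps; have [->|nx] := eqVneq x 0.
    by rewrite (mchar0 Hc) (mchar0 Hr) invr0.
  by move=> /(canRL (mulKf (mchar_neq0 Hc nx))) ->; rewrite mulr1.
have nr : ~~ ch_eq r eps.
  apply: contra ncr => /ch_eqP rE; rewrite -[c]chinvK -Dr rE chinv_eps.
  by rewrite andbb; apply/ch_eqP.
have R := gauss_reflection Hc; rewrite -Dr gauss0_nontriv // in R.
have rN1 : r (-1) = c (-1).
  rewrite Dr /chinv; apply: (mulfI (mchar_neq0 Hc N1)).
  by rewrite mulfV ?mchar_neq0 // -expr2 mchar_sqN1.
have J1 : c (-1) * (J + 1) = 0.
  transitivity (c (-1) * q - (- c (-1) * 1 * J + c (-1) * 1 * (q - 1))); first by ring.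
  by rewrite -[X in X - _]R E crE gauss_eps rN1 subrr.
rewrite crE gauss0_eps -[RHS]mulrA R mulNr mulrA -expr2 mchar_sqN1 //.
move/eqP: J1; rewrite mulf_eq0 (negPf (mchar_neq0 Hc N1)) addr_eq0 => /eqP->.
by rewrite mulrN1 mul1r.
Qed.

(** * Twisted Kloosterman sums, the functions W_{a,b} of the overview *)

Definition kloosterman a b z : algC := \sum_s a s * b (z / s) * psi (s + z / s).
Local Notation kl := kloosterman.

Lemma kloosterman0 a b : mcharb a -> mcharb b -> kl a b 0 = 0.
Proof.
by move=> Ha Hb; rewrite /kl big1 // => s _; rewrite mul0r (mchar0 Hb) mulr0 mul0r.
Qed.

Lemma kloosterman_sym a b z : mcharb a -> mcharb b -> kl a b z = kl b a z.
Proof.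
move=> Ha Hb; have [->|nz] := eqVneq z 0; first by rewrite !kloosterman0.
rewrite /kl (bigD1 0) //= [RHS](bigD1 0) //= (mchar0 Ha) (mchar0 Hb) !mul0r !add0r.
rewrite (reindex_onto (fun s => z / s) (fun s => z / s)) /=.
  apply: eq_big => [s|s /andP[ns _]].
    rewrite mulf_eq0 (negPf nz) invr_eq0 /=.
    have [->|ns] := eqVneq s 0; first by [].
    by apply/eqP; field; rewrite ns nz.
  have -> : z / (z / s) = s.
    move: ns; rewrite mulf_eq0 (negPf nz) invr_eq0 /= => ns.
    by field; rewrite ns nz.
  by rewrite [b _ * _]mulrC [s + _]addrC.
by move=> s ns; field; rewrite ns nz.
Qed.

(** For s != 0 the product c s * c (z / s) is the constant c z. *)
Lemma kloosterman_twist c a b z : mcharb a -> mcharb b -> mcharb c ->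
  kl (chmul c a) (chmul c b) z = c z * kl a b z.
Proof.
move=> Ha Hb Hc; rewrite /kl mulr_sumr; apply: eq_bigr => s _; rewrite /chmul.
have [->|ns] := eqVneq s 0; first by rewrite (mchar0 Ha) !(mulr0, mul0r).
by rewrite -[in c z](divfK ns z) (mcharM Hc (z / s)); ring.
Qed.

Lemma mellin_kloosterman a b n : mcharb a -> mcharb b -> mcharb n ->
  \sum_z n z * kl a b z = g (chmul a n) * g (chmul b n).
Proof.
move=> Ha Hb Hn; rewrite !gaussE ?mcharb_mul // mulrNN mulr_suml.
under eq_bigr do rewrite mulr_sumr.
rewrite exchange_big /=; apply: eq_bigr => s _; rewrite /chmul mulr_sumr.
have [->|ns] := eqVneq s 0.
  by rewrite !big1 // => t _; rewrite (mchar0 Ha) ?(mul0r, mulr0).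
rewrite (reindex_inj (mulfI ns)) /=; apply: eq_bigr => t _.
by rewrite [s * t]mulrC mulfK // (mcharM Hn) psi_add; ring.
Qed.

(** * Quadratic Gauss sums, Salie sums and the duplication formula *)

Hypothesis two_neq0 : (2 : F) != 0.

Lemma quadratic_gauss_sum x : x != 0 ->
  \sum_y psi (x * y ^+ 2) = - phi x * g phi.
Proof.
move=> nx; rewrite (sum_squares two_neq0 (fun t => psi (x * t))).
under eq_bigr => t _ do rewrite mulrDl mul1r [x * t]mulrC [phi t * _]mulrC.
rewrite big_split /= sum_psi (negPf nx) mul0r add0r sum_psi_twist ?mcharb_phi //.
by have := congr1 (fun f => f x) (phiV F); rewrite /chinv => ->.
Qed.

Lemma gauss_phi_sqr : g phi ^+ 2 = phi (-1) * q.
Proof.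
have := gauss_reflection (mcharb_phi F).
rewrite phiV gauss0_nontriv -?expr2 //.
by apply/ch_eqP; exact: phi_neq_eps.
Qed.

Lemma phiN1_sqr : phi (-1) * phi (-1) = 1.
Proof. by rewrite phi_sqr // oppr_eq0 oner_neq0. Qed.

(** Multiplied by - phi (-1) * g phi, the factor phi s becomes the quadratic Gauss sum of psi (- s
    y^2). Shifting y by w / s turns the total exponent into s (1 - y^2) - 2 w y. Summing over s != 0
    then selects y = 1 and y = -1, and the remaining sum over all y of psi (- 2 w y) is 0. *)
Lemma salie_sum w : w != 0 ->
  kl phi eps (w ^+ 2) = - g phi * (psi (2 * w) + psi (- (2 * w))).
Proof.
move=> nw; have nN1 : (-1 : F) != 0 by rewrite oppr_eq0 oner_neq0.
have ng := gauss_neq0 (mcharb_phi F).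
have E : - phi (-1) * g phi * kl phi eps (w ^+ 2) = q * (psi (2 * w) + psi (- (2 * w))).
  rewrite /kl mulr_sumr.
  transitivity (\sum_(s | s != 0) \sum_y psi (s * (1 - y ^+ 2)) * psi (- (2 * w * y))).
    rewrite (bigD1 0) //= (mchar0 (mcharb_phi F)) !mul0r mulr0 add0r.
    apply: eq_bigr => s ns; rewrite {1}/Defs.eps mulf_neq0 ?invr_neq0 ?expf_neq0 // mulr1.
    transitivity (psi (s + w ^+ 2 / s) * \sum_y psi (- s * y ^+ 2)).
      rewrite quadratic_gauss_sum ?oppr_eq0 // -[- s]mulN1r (mcharM (mcharb_phi F)); ring.
    rewrite mulr_sumr (reindex_inj (addrI (w / s))) /=; apply: eq_bigr => y _.
    rewrite -!psi_add; congr psi; by field.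
  rewrite exchange_big /=.
  under eq_bigr => y _ do rewrite -mulr_suml sum_psi_neq0 mulrBl mul1r.
  rewrite sumrB [X in _ - X](_ : _ = \sum_y psi (y * - (2 * w))); last first.
    by apply: eq_bigr => y _; rewrite mulrN mulrC.
  rewrite sum_psi oppr_eq0 mulf_eq0 (negPf two_neq0) (negPf nw) mul0r subr0.
  have N11 : -1 != 1 :> F.
    by rewrite -subr_eq0 -opprD oppr_eq0 -(natrD _ 1 1).
  rewrite (bigD1 1) //= (bigD1 (-1)) //= big1 => [|y /andP[y1 yN1]].
    by rewrite sqrrN expr1n subrr eqxx mulrN mulr1 opprK !mul1r; ring.
  by rewrite subr_eq0 eq_sym sqrf_eq1 (negPf y1) (negPf yN1) !mul0r.
have nf : phi (-1) != 0 := mchar_neq0 (mcharb_phi F) nN1.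
have nfg : - phi (-1) * g phi != 0 by apply: mulf_neq0; rewrite // oppr_eq0.
apply: (mulfI nfg); rewrite E.
transitivity (phi (-1) * g phi ^+ 2 * (psi (2 * w) + psi (- (2 * w)))); last by ring.
by rewrite gauss_phi_sqr mulrA phiN1_sqr mul1r.
Qed.

Lemma chmul_epsr c : mcharb c -> chmul c eps = c.
Proof. by move=> Hc; char_eq. Qed.

Lemma chmul_phi_phi : chmul phi phi = eps.
Proof. by char_eq. Qed.

(** Twisting by [phi] exchanges [phi] and [eps], and [kloosterman_sym] exchanges them back. Hence
    [kl phi eps] vanishes at nonsquares. *)
Lemma phi_kloosterman z : phi z * kl phi eps z = kl phi eps z.
Proof.
have Hp := mcharb_phi F; have He := mcharb_eps F.
by rewrite -kloosterman_twist // chmul_phi_phi chmul_epsr // kloosterman_sym.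
Qed.

(** By its support on squares, twice the sum over z is the sum over w with z = w^2. The two
    exponentials of [salie_sum] contribute equally under w -> -w, which cancels the 2; h 0 = 0
    disposes of w = 0. *)
Lemma salie_transform x (h : F -> algC) : x != 0 -> h 0 = 0 ->
  \sum_z kl phi eps (z * x ^+ 2) * h z = - g phi * \sum_w psi (2 * x * w) * h (w ^+ 2).
Proof.
move=> nx h0; have n2 : (2 : algC) != 0 by rewrite pnatr_eq0.
apply: (mulfI n2).
have <- : \sum_w kl phi eps (w ^+ 2 * x ^+ 2) * h (w ^+ 2)
    = 2 * \sum_z kl phi eps (z * x ^+ 2) * h z.
  rewrite (sum_squares two_neq0 (fun z => kl phi eps (z * x ^+ 2) * h z)) mulr_sumr.
  apply: eq_bigr => z _; rewrite mulrDl mul1r mulrA -[in phi z * _]phi_kloosterman.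
  rewrite (mcharM (mcharb_phi F)) phi_square // mulr1 [phi z * _]mulrA.
  have [->|nz] := eqVneq z 0; first by rewrite h0 !mulr0 addr0.
  by rewrite phi_sqr // mul1r; ring.
have symm : \sum_w psi (- (2 * x * w)) * h (w ^+ 2) = \sum_w psi (2 * x * w) * h (w ^+ 2).
  by rewrite (reindex_inj (@oppr_inj F)); apply: eq_bigr => w _; rewrite mulrN opprK sqrrN.
transitivity (- g phi * (\sum_w psi (2 * x * w) * h (w ^+ 2)
                         + \sum_w psi (- (2 * x * w)) * h (w ^+ 2))); last first.
  by rewrite symm; ring.
rewrite -big_split mulr_sumr /=; apply: eq_bigr => w _; rewrite -mulrDl [RHS]mulrA.
have [->|nw] := eqVneq w 0; first by rewrite expr0n /= h0 !mulr0.
rewrite -exprMn salie_sum ?mulf_neq0 //.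
by have -> : 2 * (w * x) = 2 * x * w by ring.
Qed.

(** The quadratic case of the Hasse-Davenport product formula. The product g c * g (c phi) is the
    Mellin transform of [kl phi eps] at c, which [salie_transform] turns into a Gauss sum of c^2;
    the 2 in its exponential accounts for c 4. *)
Lemma gauss_duplication c : mcharb c ->
  c 4 * (g c * g (chmul c phi)) = g phi * g (chmul c c).
Proof.
move=> Hc; have [Hp He] := (mcharb_phi F, mcharb_eps F); have Hcc := mcharb_mul Hc Hc.
have -> : g c * g (chmul c phi) = - g phi * \sum_w psi (w * 2) * chmul c c w.
  have -> : g c * g (chmul c phi) = g (chmul phi c) * g (chmul eps c).
    by rewrite mulrC; congr (g _ * g _); char_eq.
  rewrite -mellin_kloosterman //.
  have := salie_transform (oner_neq0 F) (mchar0 Hc).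
  rewrite (eq_bigr (fun z => c z * kl phi eps z)) => [->|z _]; last first.
    by rewrite expr1n mulr1 mulrC.
  congr (_ * _); apply: eq_bigr => w _.
  by rewrite mulr1 mulrC expr2 (mcharM Hc) [2 * w]mulrC mulrC.
rewrite sum_psi_twist //.
have -> : c 4 = chmul c c 2 by rewrite /chmul -(mcharM Hc) -natrM.
by field; apply: mchar_neq0.
Qed.

Lemma phi_four : phi 4 = 1.
Proof.
by have -> : 4 = 2 ^+ 2 :> F; [rewrite expr2 -natrM | rewrite phi_square].
Qed.

(** For nontrivial c, the characters c phi and c^2 are trivial simultaneously, namely when c = phi,
    so the extra q appears on both sides or on neither. *)
Lemma gauss0_duplication c : mcharb c -> ~~ ch_eq c eps ->
  c 4 * (g c * g0 (chmul c phi)) = g phi * g0 (chmul c c).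
Proof.
move=> Hc nc; have Hp := mcharb_phi F.
have [/ch_eqP cpE | ncp] := boolP (ch_eq (chmul c phi) eps).
  have -> : c = phi.
    have -> : c = chmul (chmul c phi) phi by char_eq.
    by rewrite cpE; char_eq.
  by rewrite phi_four chmul_phi_phi mul1r.
rewrite [g0 (chmul c phi)]gauss0_nontriv // gauss_duplication // gauss0_nontriv //.
apply: contra nc => /ch_eqP /(mchar_sqr_eps Hc)[-> | cE]; first exact/ch_eqP.
by case/ch_eqP: ncp; rewrite cE chmul_phi_phi.
Qed.

(* Finite-field form of Kummer's second theorem: the sum below is the Mellin
   transform of an exponential times a Bessel function. *)
Lemma mellin_exp_kloosterman h n : mcharb h -> mcharb n -> ~~ ch_eq h eps ->
  \sum_u n u * psi (2 * u) * kl (chinv (chmul h phi)) eps (u ^+ 2)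
  = h (-1) * g phi * (h 4 / n 4) * g n * g (chmul (chinv n) h)
      / g0 (chmul (chinv n) (chmul h h)).
Proof.
move=> Hh Hn nh; have [Hp He] := (mcharb_phi F, mcharb_eps F).
have N1 : (-1 : F) != 0 by rewrite oppr_eq0 oner_neq0.
pose o := chmul n (chinv (chmul h phi)).
have Ho : mcharb o by rewrite !(mcharb_mul, mcharb_inv).
pose oo := chmul (chinv o) (chinv o).
have Hoo : mcharb oo by rewrite !(mcharb_mul, mcharb_inv).
have S : \sum_u n u * psi (2 * u) * kl (chinv (chmul h phi)) eps (u ^+ 2)
   = - g o * (\sum_m n m * oo (1 + m)) + n (-1) * (ch_eq o eps)%:R * (q - 1).
  (* The substitution u = s m completes a square: 2 s m + s + s m^2 = s (1 + m)^2. *)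
  transitivity (\sum_m n m * \sum_s psi (s * (1 + m) ^+ 2) * o s).
    under eq_bigr do rewrite /kl mulr_sumr.
    under [RHS]eq_bigr do rewrite mulr_sumr.
    rewrite exchange_big [RHS]exchange_big /=; apply: eq_bigr => s _.
    have [->|ns] := eqVneq s 0.
      rewrite !big1 // => t _; first by rewrite (mchar0 Ho) !mulr0.
      by rewrite (mchar0 (mcharb_inv (mcharb_mul Hh Hp))) !(mul0r, mulr0).
    rewrite (reindex_inj (mulfI ns)) /=; apply: eq_bigr => m _.
    have [->|nm] := eqVneq m 0; first by rewrite mulr0 (mchar0 Hn) !mul0r.
    rewrite {1}/Defs.eps mulf_neq0 ?invr_neq0 ?expf_neq0 ?mulf_neq0 // mulr1.
    rewrite (mcharM Hn) /o /chmul.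
    have -> : s * (1 + m) ^+ 2 = 2 * (s * m) + (s + (s * m) ^+ 2 / s) by field.
    by rewrite (psi_add (2 * (s * m))); ring.
  (* At m = -1 the exponential disappears and the inner sum is that of o alone, the source of the
     correction term. Every other m gives a Gauss sum of o, and summing these over m gives a Jacobi
     sum. *)
  rewrite (bigD1 (-1)) //= [in RHS](bigD1 (-1)) //= subrr (mchar0 Hoo) mulr0 add0r.
  rewrite addrC [- g o * _]mulr_sumr; congr (_ + _); last first.
    rewrite -mulrA -sum_mchar //; congr (_ * _); apply: eq_bigr => s _.
    by rewrite expr0n mulr0 psi0 mul1r.
  apply: eq_bigr => m nm; have n1m : 1 + m != 0 by rewrite addrC addr_eq0.
  rewrite sum_psi_twist ?expf_neq0 // expr2 (mcharM Ho) invfM /oo /chmul /chinv.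
  by ring.
rewrite S.
have N4 : (4 : F) != 0 by rewrite (natrM _ 2 2) mulf_neq0.
have n4 := mchar_neq0 Hn N4; have h4 := mchar_neq0 Hh N4.
have ng := gauss_neq0 Hp.
(* For o trivial, n = h phi and the Jacobi sum is elementary. The total is n (-1) q if n is
   nontrivial and 1 if n is trivial, that is, n (-1) q (g n / g0 n) in both cases. *)
have [/ch_eqP oE | no] := boolP (ch_eq o eps).
  have Dn : n = chmul h phi.
    have -> : n = chmul o (chmul h phi) by rewrite /o; char_eq.
    by rewrite oE; char_eq.
  have -> : chmul (chinv n) h = phi by rewrite Dn; char_eq.
  have -> : chmul (chinv n) (chmul h h) = n by rewrite Dn; char_eq.
  have -> : h 4 / n 4 = 1 by rewrite Dn /chmul phi_four mulr1 divff.
  have -> : \sum_m n m * oo (1 + m) = (ch_eq n eps)%:R * (q - 1) - n (-1).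
    rewrite -sum_mchar // [in RHS](bigD1 (-1)) //= [in LHS](bigD1 (-1)) //=.
    rewrite subrr (mchar0 Hoo) mulr0 add0r addrAC subrr add0r; apply: eq_bigr => m nm.
    by rewrite /oo oE /chmul /chinv /Defs.eps addrC addr_eq0 nm invr1 !mulr1.
  transitivity (n (-1) * q * (g n / g0 n)); last first.
    transitivity (h (-1) * g phi ^+ 2 * (g n / g0 n)); last by ring.
    by rewrite gauss_phi_sqr (_ : n (-1) = h (-1) * phi (-1)) ?Dn //; ring.
  rewrite oE gauss_eps.
  have [/ch_eqP nE | ne] := boolP (ch_eq n eps).
    rewrite nE gauss_eps gauss0_eps /Defs.eps N1 /=; field; exact: qC_neq0.
  rewrite gauss0_nontriv // divff ?gauss_neq0 //=; ring.
have noi : ~~ ch_eq (chinv o) eps.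
  by apply: contra no => /ch_eqP oE; rewrite -[o]chinvK oE chinv_eps; apply/ch_eqP.
(* If both were trivial, h^2 would be trivial, so h = phi, and then o would be trivial. *)
have nno : ~~ (ch_eq n eps && ch_eq oo eps).
  apply/negP => /andP[/ch_eqP nE /ch_eqP ooE].
  have hh : chmul h h = eps.
    rewrite -ooE; have -> : chmul h h = chmul (chmul n n) oo by rewrite /oo /o; char_eq.
    by rewrite nE ooE; char_eq.
  case: (mchar_sqr_eps Hh hh) => hE; first by case/ch_eqP: nh.
  by case/ch_eqP: no; rewrite /o nE hE; char_eq.
rewrite /= mulr0 mul0r addr0.
have J := jacobi_sum Hn Hoo nno.
have Dno : chmul n oo = chmul (chinv n) (chmul h h) by rewrite /oo /o; char_eq.
(* As mu^2 = oo and mu phi = o^-1, duplication at mu expresses g oo by g mu * g (o^-1), whose second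
   factor meets g o in the reflection formula. *)
set mu := chmul (chinv n) h; have Hmu : mcharb mu by rewrite mcharb_mul ?mcharb_inv.
have Dup := gauss_duplication Hmu; have R := gauss_reflection Ho.
have Doi : chmul mu phi = chinv o by rewrite /mu /o; char_eq.
have Doo : chmul mu mu = oo by rewrite /mu /oo /o; char_eq.
rewrite gauss0_nontriv // -Doi in R; rewrite Doi Doo -Doi in Dup; rewrite Dno in J.
have Hg0 : g0 (chmul (chinv n) (chmul h h)) != 0.
  by rewrite gauss0_neq0 // -Dno mcharb_mul.
apply: (mulIf Hg0); rewrite divfK // -[LHS]mulrA [_ * g0 _]mulrC J.
apply: (mulfI ng).
have -> : g phi * (- g o * (- n (-1) * g n * g oo)) = g o * n (-1) * g n * (g phi * g oo).
  by ring.
rewrite -Dup.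
have -> : g o * n (-1) * g n * (mu 4 * (g mu * g (chmul mu phi)))
   = (g o * g (chmul mu phi)) * n (-1) * g n * mu 4 * g mu by ring.
rewrite R.
have -> : o (-1) * q * n (-1) = h (-1) * g phi ^+ 2.
  rewrite gauss_phi_sqr /o /chmul /chinv.
  have := mchar_sqN1 Hn; have := mchar_sqN1 Hh; have := mchar_sqN1 Hp.
  have := mchar_neq0 Hh N1; have := mchar_neq0 Hp N1.
  move: (n (-1)) (h (-1)) (phi (-1)) => u v w nw nv w2 v2 u2.
  transitivity (u ^+ 2 / (v * w) * q); first by ring.
  rewrite u2; transitivity (v ^+ 2 * w ^+ 2 / (v * w) * q); first by rewrite v2 w2 mulr1.
  by field; rewrite nw nv.
by rewrite /mu /chmul /chinv; field.
Qed.

(** * Appell's series as a sum of products of Kloosterman sums *)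

Lemma poch0V c n : mcharb c -> mcharb n ->
  (poch0 psi c n)^-1 = g0 c * (c (-1) * n (-1) * g (chinv (chmul c n)) / q).
Proof. by move=> Hc Hn; rewrite invf_div gauss0V ?mcharb_mul. Qed.

(** Once [poch0V] has cleared the denominators, each summand is a product of Mellin transforms of
    Kloosterman sums at n1 n2, n1^-1 and n2^-1. Expanding only the first leaves two independent
    Mellin inversions, whose factor (q - 1)^2 cancels the normalization. *)
Lemma appellF4_kloosterman a b c1 c2 x y :
  mcharb a -> mcharb b -> mcharb c1 -> mcharb c2 ->
  appellF4 psi a b c1 c2 x y
  = g0 c1 * g0 c2 * (c1 (-1) * c2 (-1)) / (q ^+ 2 * (g a * g b))
    * \sum_z kl a b z * kl (chinv c1) eps (z * x) * kl (chinv c2) eps (z * y).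
Proof.
move=> Ha Hb Hc1 Hc2; have He := mcharb_eps F; set D := _ / _.
pose A c n t z := n (z * t) * \sum_u chinv n u * kl (chinv c) eps u.
have AE c t z : mcharb c -> sum_chars (fun n => A c n t z) = (q - 1) * kl (chinv c) eps (z * t).
  by move=> Hc; rewrite mellin_inversion // kloosterman0 ?mcharb_inv.
transitivity (((1 - q) ^+ 2)^-1 * sum_chars (fun n1 => sum_chars (fun n2 =>
    \sum_z D * (kl a b z * (A c1 n1 x z * A c2 n2 y z))))).
  congr (_ * _); apply: eq_sum_chars => n1 Hn1; apply: eq_sum_chars => n2 Hn2.
  have Hn := mcharb_mul Hn1 Hn2; rewrite -mulr_sumr.
  have -> : \sum_z kl a b z * (A c1 n1 x z * A c2 n2 y z)
    = g (chmul a (chmul n1 n2)) * g (chmul b (chmul n1 n2)) * (n1 x * n2 y)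
      * (g (chinv (chmul c1 n1)) * g (chinv (chmul eps n1)))
      * (g (chinv (chmul c2 n2)) * g (chinv (chmul eps n2))).
    rewrite -mellin_kloosterman // !chinvM chinv_eps -!mellin_kloosterman ?mcharb_inv //.
    rewrite !mulr_suml; apply: eq_bigr => z _; rewrite /A (mcharM Hn1) (mcharM Hn2) /chmul.
    by ring.
  have div4 (t p1 p2 p3 p4 : algC) :
      t / (p1 * p2 * p3 * p4) = t * (p1^-1 * p2^-1 * p3^-1 * p4^-1) by rewrite !invfM.
  rewrite div4 !poch0V // /poch gauss0_eps /D.
  have -> : eps (-1) = 1 by rewrite /Defs.eps oppr_eq0 oner_neq0.
  have s1 := mchar_sqN1 Hn1; have s2 := mchar_sqN1 Hn2.
  have [na nb nq] := And3 (gauss_neq0 Ha) (gauss_neq0 Hb) qC_neq0.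
  (* Each of n1 (-1) and n2 (-1) occurs twice on the left, once per inverted denominator; their
     squares, equal to 1, are inserted on the right for [field]. *)
  rewrite -[RHS]mul1r -[in RHS](mulr1 1) -[X in _ = X * _ * _]s1 -[X in _ = _ * X * _]s2.
  move: (g a) (g b) q na nb nq => ga gb q' na nb nq.
  by field; rewrite na nb nq.
have -> : sum_chars (fun n1 => sum_chars (fun n2 =>
    \sum_z D * (kl a b z * (A c1 n1 x z * A c2 n2 y z))))
  = D * (q - 1) ^+ 2 * \sum_z kl a b z * kl (chinv c1) eps (z * x) * kl (chinv c2) eps (z * y).
  transitivity (\sum_z D * (kl a b z * ((sum_chars (fun n => A c1 n x z))
                                          * (sum_chars (fun n => A c2 n y z))))).
    under eq_sum_chars do rewrite exchange_sum_chars.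
    rewrite exchange_sum_chars; apply: eq_bigr => z _.
    have -> : sum_chars (fun n => A c1 n x z) * sum_chars (fun n => A c2 n y z)
        = sum_chars (fun n1 => sum_chars (fun n2 => A c1 n1 x z * A c2 n2 y z)).
      exact: big_distrlr.
    rewrite !mulr_sum_chars; apply: eq_sum_chars => n1 _.
    by rewrite !mulr_sum_chars.
  rewrite mulr_sumr; apply: eq_bigr => z _; rewrite !AE //; ring.
have := qC_neq1; move: q => q' nq; field.
by rewrite -opprB oppr_eq0 nq.
Qed.

(** Twisting a and b by [phi] multiplies [kl a b z] by phi z, which [kl phi eps (z * m ^+ 2)]
    absorbs by its support on squares; for m = 0 that factor is itself 0. Only the Gauss sums in
    front change. *)
Lemma appellF4_phi_twist a b c x m : mcharb a -> mcharb b -> mcharb c ->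
  appellF4 psi a b c phi x (m ^+ 2)
  = poch psi a phi * poch psi b phi
    * appellF4 psi (chmul a phi) (chmul b phi) c phi x (m ^+ 2).
Proof.
move=> Ha Hb Hc; have [Hp He] := (mcharb_phi F, mcharb_eps F).
rewrite !appellF4_kloosterman ?mcharb_mul // phiV.
have -> : \sum_z kl (chmul a phi) (chmul b phi) z * kl (chinv c) eps (z * x)
            * kl phi eps (z * m ^+ 2)
        = \sum_z kl a b z * kl (chinv c) eps (z * x) * kl phi eps (z * m ^+ 2).
  apply: eq_bigr => z _.
  have -> : chmul a phi = chmul phi a by char_eq.
  have -> : chmul b phi = chmul phi b by char_eq.
  rewrite kloosterman_twist //.
  have [->|nm] := eqVneq m 0; first by rewrite expr0n mulr0 kloosterman0 ?mulr0.
  rewrite -[in RHS]phi_kloosterman (mcharM Hp) phi_square // mulr1; ring.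
have nga := gauss_neq0 Ha; have ngb := gauss_neq0 Hb.
have ngap := gauss_neq0 (mcharb_mul Ha Hp); have ngbp := gauss_neq0 (mcharb_mul Hb Hp).
rewrite /poch; field; by rewrite nga ngb ngap ngbp qC_neq0.
Qed.

(** * Reduction of the Appell series and of the 3F2 series to one Bessel-type sum *)

Section F4Reduction.
Variables a b c : F -> algC.
Hypotheses (Ha : mcharb a) (Hb : mcharb b) (Hc : mcharb c).

Let Hp : mcharb phi := mcharb_phi F.
Let He : mcharb eps := mcharb_eps F.
Let Hbi : mcharb (chinv b) := mcharb_inv Hb.
Let Hcpi : mcharb (chinv (chmul c phi)) := mcharb_inv (mcharb_mul Hc Hp).
Let Habi : mcharb (chinv (chmul a (chinv b))) := mcharb_inv (mcharb_mul Ha Hbi).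

(** The sum S(l) of the overview, a finite analogue of integrating an exponential against two Bessel
    functions. *)
Definition bessel_sum (l : F) : algC :=
  \sum_u chmul a a u * psi (2 * (1 - l) * u) * kl (chinv (chmul a (chinv b))) eps (u ^+ 2)
     * kl (chinv (chmul c phi)) eps ((l * u) ^+ 2).

Lemma kloosterman_factor z : kl a b z = a z * kl (chinv (chmul a (chinv b))) eps z.
Proof.
rewrite [kl _ eps z]kloosterman_sym // -kloosterman_twist // chmul_epsr //.
by congr (kl _ _ z); char_eq.
Qed.

(** The last factor is the Salie sum, so [salie_transform] applies with x = 1 - l; under z = u^2 the
    factor a z of [kl a b z] becomes a^2 at u. *)
Lemma bessel_sum_phi l : l != 1 ->
  \sum_z kl a b z * kl (chinv (chmul c phi)) eps (z * l ^+ 2)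
     * kl (chinv phi) eps (z * (1 - l) ^+ 2)
  = - g phi * bessel_sum l.
Proof.
move=> nl; have nl1 : 1 - l != 0 by rewrite subr_eq0 eq_sym.
pose h z := kl a b z * kl (chinv (chmul c phi)) eps (z * l ^+ 2).
have h0 : h 0 = 0 by rewrite /h kloosterman0 // mul0r.
transitivity (\sum_z kl phi eps (z * (1 - l) ^+ 2) * h z).
  by apply: eq_bigr => z _; rewrite phiV mulrC.
rewrite salie_transform //; congr (_ * _); apply: eq_bigr => u _.
rewrite /h kloosterman_factor -exprMn [u * l]mulrC expr2 (mcharM Ha) /chmul.
by rewrite -expr2; ring.
Qed.

(** Here the Salie sum is the first factor, a z times [kl phi eps z], so x = 1. Rescaling u by 1 - l
    clears the denominators and brings out a^2 (1 - l). *)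
Lemma bessel_sum_a_aphi l : l != 1 ->
  \sum_z kl a (chmul a phi) z * kl (chinv (chmul c phi)) eps (z * (l ^+ 2 / (1 - l) ^+ 2))
     * kl (chinv (chmul a (chinv b))) eps (z * ((1 - l) ^+ 2)^-1)
  = - g phi * (chmul a a (1 - l) * bessel_sum l).
Proof.
move=> nl; have nl1 : 1 - l != 0 by rewrite subr_eq0 eq_sym.
pose h z := a z * kl (chinv (chmul c phi)) eps (z * (l ^+ 2 / (1 - l) ^+ 2))
     * kl (chinv (chmul a (chinv b))) eps (z * ((1 - l) ^+ 2)^-1).
have h0 : h 0 = 0 by rewrite /h (mchar0 Ha) !mul0r.
transitivity (\sum_z kl phi eps (z * 1 ^+ 2) * h z).
  apply: eq_bigr => z _; rewrite /h expr1n mulr1.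
  rewrite -[X in kl X _ z](chmul_epsr Ha) kloosterman_twist // kloosterman_sym //.
  by ring.
rewrite salie_transform ?oner_neq0 //; congr (_ * _).
rewrite (reindex_inj (mulfI nl1)) mulr_sumr; apply: eq_bigr => u _ /=.
rewrite /h mulr1 /chmul !expr2 !(mcharM Ha) [2 * (_ * _)]mulrA.
have -> : (1 - l) * u * ((1 - l) * u) * (l * l / ((1 - l) * (1 - l))) = l * u * (l * u).
  by field.
have -> : (1 - l) * u * ((1 - l) * u) / ((1 - l) * (1 - l)) = u * u by field.
by ring.
Qed.

Lemma F32E l : 
  F32 psi (chmul a a) (chmul b b) c (chmul (chmul a b) phi) (chmul c c) l
  = q * g0 (chmul (chmul a b) phi) * g0 (chmul c c)
      / ((1 - q) * g (chmul a a) * g (chmul b b) * g c)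
    * sum_chars (fun n => n l * g (chmul (chmul a a) n) * g (chmul (chmul b b) n)
        * g (chmul c n) / (g0 n * g0 (chmul (chmul (chmul a b) phi) n)
                           * g0 (chmul (chmul c c) n))).
Proof.
rewrite /F32 !mulr_sum_chars; apply: eq_sum_chars => n Hn.
rewrite /poch /poch0 (_ : chmul eps n = n); last by char_eq.
rewrite gauss0_eps.
have nz m : mcharb m -> g m != 0 := @gauss_neq0 m.
have nz0 m : mcharb m -> g0 m != 0 := @gauss0_neq0 m.
have := nz _ (mcharb_mul Ha Ha); have := nz _ (mcharb_mul Hb Hb); have := nz _ Hc.
have := nz0 _ Hn; have := nz0 _ (mcharb_mul (mcharb_mul (mcharb_mul Ha Hb) Hp) Hn).
have := nz0 _ (mcharb_mul (mcharb_mul Hc Hc) Hn); have := nz0 _ (mcharb_mul Hc Hc).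
have := nz0 _ (mcharb_mul (mcharb_mul Ha Hb) Hp).
have := qC_neq0; have : 1 - q != 0 by rewrite -opprB oppr_eq0 qC_neq1.
move=> h1 h2 h3 h4 h5 h6 h7 h8 h9 h10.
field.
by rewrite h1 h2 h3 h4 h5 h6 h7 h8 h9 h10.
Qed.

Hypothesis abphi : ~~ ch_eq (chmul (chmul a (chinv b)) phi) eps.
Hypothesis c_neq : ~~ ch_eq c eps.

(** Expanding f (l u) in characters n leaves the Mellin transforms of f at n^-1 and of A at n. Both
    come from [mellin_exp_kloosterman], with h = c and h = a b^-1 phi, the two characters assumed
    nontrivial. *)
Lemma bessel_sum_clausen l :
  (q - 1) * bessel_sum l
  = c (-1) * (c 4 / (a 4 * b 4)) * g phi ^+ 2 * q *
    sum_chars (fun n => n l * g (chmul (chmul a a) n) * g (chmul (chmul b b) n)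
        * g (chmul c n) / (g0 n * g0 (chmul (chmul (chmul a b) phi) n)
                           * g0 (chmul (chmul c c) n))).
Proof.
pose f u := psi (- (2 * u)) * kl (chinv (chmul c phi)) eps (u ^+ 2).
pose A u := chmul a a u * psi (2 * u) * kl (chinv (chmul a (chinv b))) eps (u ^+ 2).
have f0 : f 0 = 0 by rewrite /f expr0n kloosterman0 ?mulr0.
have -> : bessel_sum l = \sum_u A u * f (l * u).
  apply: eq_bigr => u _; rewrite /A /f.
  have -> : 2 * (1 - l) * u = 2 * u + - (2 * (l * u)) by ring.
  by rewrite psi_add; ring.
rewrite mulr_sumr.
transitivity (sum_chars (fun n => n l * (\sum_v chinv n v * f v) * \sum_u n u * A u)).
  under [RHS]eq_sum_chars do rewrite mulr_sumr.
  rewrite exchange_sum_chars; apply: eq_bigr => u _.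
  rewrite mulrCA -mellin_inversion // mulr_sum_chars.
  by apply: eq_sum_chars => n Hn; rewrite (mcharM Hn); ring.
rewrite mulr_sum_chars; apply: eq_sum_chars => n Hn; have Hni := mcharb_inv Hn.
have N1 : (-1 : F) != 0 by rewrite oppr_eq0 oner_neq0.
have N4 : (4 : F) != 0 by rewrite (natrM _ 2 2) mulf_neq0.
(* The opposite sign in the exponential of f is removed by v -> -v, at the cost of n (-1). *)
have -> : \sum_v chinv n v * f v
    = n (-1) * \sum_u chinv n u * psi (2 * u) * kl (chinv (chmul c phi)) eps (u ^+ 2).
  rewrite (reindex_inj (@oppr_inj F)) mulr_sumr; apply: eq_bigr => u _.
  rewrite /f mulrN opprK sqrrN -[- u]mulN1r (mcharM Hni) {1}/chinv.
  have -> : (n (-1))^-1 = n (-1).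
    apply: (mulfI (mchar_neq0 Hn N1)).
    by rewrite mulfV ?mchar_neq0 // -expr2 mchar_sqN1.
  by ring.
rewrite mellin_exp_kloosterman // chinvK.
have -> : \sum_u n u * A u
    = \sum_u chmul (chmul a a) n u * psi (2 * u)
        * kl (chinv (chmul (chmul (chmul a (chinv b)) phi) phi)) eps (u ^+ 2).
  apply: eq_bigr => u _; rewrite /A.
  have -> : chinv (chmul (chmul (chmul a (chinv b)) phi) phi) = chinv (chmul a (chinv b)).
    by char_eq.
  by rewrite /chmul; ring.
rewrite mellin_exp_kloosterman ?mcharb_mul //.
have -> : chmul (chinv (chmul (chmul a a) n)) (chmul (chmul a (chinv b)) phi)
   = chinv (chmul (chmul (chmul a b) phi) n) by char_eq.
have -> : chmul (chinv (chmul (chmul a a) n)) (chmul (chmul (chmul a (chinv b)) phi)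
     (chmul (chmul a (chinv b)) phi)) = chinv (chmul (chmul b b) n) by char_eq.
have -> : chmul n (chmul c c) = chmul (chmul c c) n by char_eq.
have -> : chmul n c = chmul c n by char_eq.
have div3 (t p1 p2 p3 : algC) : t / (p1 * p2 * p3) = t * (p1^-1 * p2^-1 * p3^-1).
  by rewrite !invfM.
(* Reflection moves all Gauss sums into numerators except g0 (c^2 n), which stands in the
   denominator on both sides. *)
rewrite div3 [(g0 n)^-1]gauss0V // [(g0 (chmul _ n))^-1 in RHS]gauss0V ?mcharb_mul //.
rewrite [(g0 (chinv _))^-1]gauss0V ?mcharb_mul ?mcharb_inv ?mcharb_mul // chinvK.
have n4 := mchar_neq0 Hn N4; have a4 := mchar_neq0 Ha N4; have b4 := mchar_neq0 Hb N4.
have nq := qC_neq0; have ng0 := gauss0_neq0 (mcharb_mul (mcharb_mul Hc Hc) Hn).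
rewrite !(chmulE, chinvE) phi_four.
case: (mcharN1 Hn) => ->; case: (mcharN1 Hb) => ->.
all: by field; rewrite ?n4 ?a4 ?b4 ?nq ?ng0 //.
Qed.

Lemma gauss0_ab : g0 (chmul a (chinv b)) = (a (-1) / b (-1)) * q / g (chmul (chinv a) b).
Proof.
have Hm := mcharb_mul (mcharb_inv Ha) Hb; have N1 : (-1 : F) != 0 by rewrite oppr_eq0 oner_neq0.
apply: (mulIf (gauss_neq0 Hm)); rewrite divfK ?gauss_neq0 //.
have -> : chmul a (chinv b) = chinv (chmul (chinv a) b) by char_eq.
rewrite mulrC gauss_reflection // /chmul /chinv; congr (_ * _).
by case: (mcharN1 Ha) => ->; case: (mcharN1 Hb) => ->; field.
Qed.

Lemma appellF4_a_aphi l : l != 1 ->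
  chmul (chinv a) (chinv a) (1 - l)
    * appellF4 psi a (chmul a phi) (chmul c phi) (chmul a (chinv b))
        (l ^+ 2 / (1 - l) ^+ 2) (((1 - l) ^+ 2)^-1)
  = - g0 (chmul c phi) * c (-1) * phi (-1) * g phi
      / (q * g a * g (chmul a phi) * g (chmul (chinv a) b)) * bessel_sum l.
Proof.
move=> nl; have nl1 : 1 - l != 0 by rewrite subr_eq0 eq_sym.
rewrite appellF4_kloosterman ?mcharb_mul // bessel_sum_a_aphi // gauss0_ab.
have N1 : (-1 : F) != 0 by rewrite oppr_eq0 oner_neq0.
rewrite !(chmulE, chinvE).
have a1 := mchar_neq0 Ha nl1; have nga := gauss_neq0 Ha.
have ngap := gauss_neq0 (mcharb_mul Ha Hp).
have ngab := gauss_neq0 (mcharb_mul (mcharb_inv Ha) Hb).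
have nq := qC_neq0.
by case: (mcharN1 Ha) => ->; case: (mcharN1 Hb) => ->; field; rewrite a1 nga ngap ngab nq.
Qed.

Lemma appellF4_phi l : l != 1 ->
  appellF4 psi a b (chmul c phi) phi (l ^+ 2) ((1 - l) ^+ 2)
  = - g0 (chmul c phi) * c (-1) * g phi ^+ 2 / (q ^+ 2 * g a * g b) * bessel_sum l.
Proof.
move=> nl; rewrite appellF4_kloosterman ?mcharb_mul // bessel_sum_phi //.
rewrite [g0 phi]gauss0_nontriv; last by apply/ch_eqP; exact: phi_neq_eps.
rewrite chmulE -(mulrA _ _ (phi _)) phiN1_sqr mulr1.
by field; rewrite qC_neq0 (gauss_neq0 Ha) (gauss_neq0 Hb).
Qed.

Lemma appellF4_phi_a_aphi l : l != 1 ->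
  appellF4 psi a b (chmul c phi) phi (l ^+ 2) ((1 - l) ^+ 2)
  = g (chmul (chinv a) b) * g (chmul a phi) / (g b * g phi)
    * chmul (chinv a) (chinv a) (1 - l)
    * appellF4 psi a (chmul a phi) (chmul c phi) (chmul a (chinv b))
        (l ^+ 2 / (1 - l) ^+ 2) (((1 - l) ^+ 2)^-1).
Proof.
move=> nl; rewrite -[RHS]mulrA appellF4_a_aphi // appellF4_phi //.
have nga := gauss_neq0 Ha; have ngb := gauss_neq0 Hb; have ngp := gauss_neq0 Hp.
have ngap := gauss_neq0 (mcharb_mul Ha Hp).
have ngab := gauss_neq0 (mcharb_mul (mcharb_inv Ha) Hb).
have nq := qC_neq0; rewrite gauss_phi_sqr.
by field; rewrite nga ngb ngp ngap ngab nq.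
Qed.

(** What remains after [bessel_sum_clausen] is to match constants: duplication at a, b and c removes
    the Gauss sums twisted by [phi] and cancels the values at 4. At c the [g0] version is needed,
    since c phi may be trivial. *)
Lemma appellF4_a_aphi_F32 l : l != 1 ->
  chmul (chinv a) (chinv a) (1 - l)
    * appellF4 psi a (chmul a phi) (chmul c phi) (chmul a (chinv b))
        (l ^+ 2 / (1 - l) ^+ 2) (((1 - l) ^+ 2)^-1)
  = g b * g (chmul b phi) / (g (chmul (chinv a) b) * g0 (chmul (chmul a b) phi))
    * F32 psi (chmul a a) (chmul b b) c (chmul (chmul a b) phi) (chmul c c) l.
Proof.
move=> nl; rewrite appellF4_a_aphi // F32E.
have S := bessel_sum_clausen l; move: S; set R := sum_chars _ => S.
have nq1 := qC_neq1; have nq := qC_neq0.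
have nq1' : 1 - q != 0 by rewrite -opprB oppr_eq0.
have nga := gauss_neq0 Ha; have ngb := gauss_neq0 Hb; have ngp := gauss_neq0 Hp.
have ngc := gauss_neq0 Hc.
have ngaa := gauss_neq0 (mcharb_mul Ha Ha); have ngbb := gauss_neq0 (mcharb_mul Hb Hb).
have ngap := gauss_neq0 (mcharb_mul Ha Hp).
have ngab := gauss_neq0 (mcharb_mul (mcharb_inv Ha) Hb).
have ngabp := gauss0_neq0 (mcharb_mul (mcharb_mul Ha Hb) Hp).
have N1 : (-1 : F) != 0 by rewrite oppr_eq0 oner_neq0.
have N4 : (4 : F) != 0 by rewrite (natrM _ 2 2) mulf_neq0.
have a4 := mchar_neq0 Ha N4; have b4 := mchar_neq0 Hb N4; have c4 := mchar_neq0 Hc N4.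
have p1 := mchar_neq0 Hp N1.
have -> : bessel_sum l = c (-1) * (c 4 / (a 4 * b 4)) * g phi ^+ 2 * q * R / (q - 1).
  by rewrite -S mulrAC divff ?mul1r.
have -> : g0 (chmul c phi) = g phi * g0 (chmul c c) / (c 4 * g c).
  by rewrite -gauss0_duplication //; field; rewrite c4 ngc.
have -> : g (chmul b phi) = g phi * g (chmul b b) / (b 4 * g b).
  by rewrite -gauss_duplication //; field; rewrite b4 ngb.
have Eap : g a * g (chmul a phi) = g phi * g (chmul a a) / a 4.
  by rewrite -gauss_duplication //; field; rewrite a4.
rewrite -[q * g a * _]mulrA Eap.
have cc := mchar_sqN1 Hc.
(* The intermediate form isolates c (-1)^2 = 1 and phi (-1) * g phi ^+ 2 = q, two relations that
   [field] does not know. *)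
transitivity (c (-1) ^+ 2 * (phi (-1) * g phi ^+ 2) * g phi * g0 (chmul c c)
    / ((1 - q) * b 4 * g c * g (chmul a a) * g (chmul (chinv a) b)) * R); last first.
  have -> : phi (-1) * g phi ^+ 2 = q by rewrite gauss_phi_sqr mulrA phiN1_sqr mul1r.
  rewrite cc.
  by field; rewrite nq1' ngab ngabp ngaa ngbb ngb ngc b4.
by field; rewrite nq1 nq1' nq ngab ngaa ngp ngc a4 b4 c4.
Qed.

End F4Reduction.
End GaussSums.

Theorem theorem3p16 (F : finFieldType) (psi : F -> algC)
  (psi_add : forall x y : F, psi (x + y) = psi x * psi y)
  (psi_unit : forall x : F, psi x != 0)
  (psi_nontriv : exists x : F, psi x != 1)
  (char_not2 : ~~ (2%N \in [pchar F]))
  (alpha beta gamma : F -> algC)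
  (Ha : mcharb alpha) (Hb : mcharb beta) (Hc : mcharb gamma) :
  (* (i) *)
  (forall l : F,
     appellF4 psi alpha beta (chmul gamma (@phi F)) (@phi F) (l ^+ 2) ((1 - l) ^+ 2)
     = poch psi alpha (@phi F) * poch psi beta (@phi F)
       * appellF4 psi (chmul alpha (@phi F)) (chmul beta (@phi F))
                  (chmul gamma (@phi F)) (@phi F) (l ^+ 2) ((1 - l) ^+ 2))
  /\
  (* (ii) *)
  (~~ ch_eq alpha (@eps F) -> ~~ ch_eq (chmul (chinv beta) gamma) (@eps F) ->
   forall l : F, l != 1 ->
     appellF4 psi alpha beta (chmul gamma (@phi F)) (@phi F) (l ^+ 2) ((1 - l) ^+ 2)
     = gauss psi (chmul (chinv alpha) beta) * gauss psi (chmul alpha (@phi F))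
         / (gauss psi beta * gauss psi (@phi F))
       * chmul (chinv alpha) (chinv alpha) (1 - l)
       * appellF4 psi alpha (chmul alpha (@phi F)) (chmul gamma (@phi F))
                  (chmul alpha (chinv beta))
                  (l ^+ 2 / (1 - l) ^+ 2) (((1 - l) ^+ 2)^-1))
  /\
  (* (iii) *)
  (~~ ch_eq (chmul (chmul alpha (chinv beta)) (@phi F)) (@eps F) ->
   ~~ ch_eq gamma (@eps F) ->
   forall l : F, l != 1 ->
     chmul (chinv alpha) (chinv alpha) (1 - l)
       * appellF4 psi alpha (chmul alpha (@phi F)) (chmul gamma (@phi F))
                  (chmul alpha (chinv beta))
                  (l ^+ 2 / (1 - l) ^+ 2) (((1 - l) ^+ 2)^-1)
     = gauss psi beta * gauss psi (chmul beta (@phi F))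
         / (gauss psi (chmul (chinv alpha) beta)
            * gauss0 psi (chmul (chmul alpha beta) (@phi F)))
       * F32 psi (chmul alpha alpha) (chmul beta beta) gamma
             (chmul (chmul alpha beta) (@phi F)) (chmul gamma gamma) l).
Proof.
have two_neq0 : (2 : F) != 0 by move: char_not2; rewrite inE.
split=> [l|]; first by apply: appellF4_phi_twist => //; apply: mcharb_mul => //; apply: mcharb_phi.
split=> [_ _ l nl | abphi c_neq l nl].
  exact: appellF4_phi_a_aphi.
exact: appellF4_a_aphi_F32.
Qed.
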